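(* Let $n\ge2$, let $A,B_1,\ldots,B_n,C_1,\ldots,C_n\in\widehat{\mathbb F_q}$ and $x_1,\ldots,x_n\in\mathbb F_q$. Let $k,l\in\{1,\ldots,n\}$ with $k\neq l$, $x_l\ne0$ and $x_k\neq 0$. Then $$\begin{aligned}F_A^{(n)}&\left[A;B_1,\ldots,B_n;C_1,\ldots,C_n\mid x_1,\ldots,x_n\right]\\&=\frac{B_kC_k(-1)}{q}\,\overline{B_k}C_k(x_k-1)\,\overline{C_k}(x_k)\,\overline{A}(-x_l)\,C_l(-1)\;F_A^{(n-1)}\left[A;(B_i')_{i\ne k};(C_i)_{i\neq k}\mid (y_i)_{i\neq k}\right]\\&\quad+\frac{B_kC_k(-1)}{q}\sum_{t_k\in\mathbb F_q,\ t_k\ne x_k^{-1}}B_k(t_k)\,\overline{B_k}C_k(1-t_k)\,\overline{A}(1-x_kt_k)\;F_A^{(n-1)}\left[A;(B_i)_{i\ne k};(C_i)_{i\ne k}\,\Big|\,\Big(\frac{x_i}{1-x_kt_k}\Big)_{i\ne k}\right],\end{aligned}$$ where $B_l'=\overline{B_l}C_l$ and $B_i'=B_i$ for $i\ne k,l$, while $y_l=1$ and $y_i=-x_i/x_l$ for $i\neq k,l$, and all lists $(\cdot)_{i\ne k}$ are indexed by $i\in\{1,\ldots,n\}\setminus\{k\}$ in increasing order.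
   Context: Let $p$ be an odd prime, $q=p^r$ with $r\ge1$, and $\mathbb F_q$ the field with $q$ elements. $\widehat{\mathbb F_q}$ is the group of multiplicative characters $\chi:\mathbb F_q^\times\to\mathbb C^\times$, each extended to $\mathbb F_q$ by $\chi(0)=0$ (including the trivial character $\epsilon$, so $\epsilon(0)=0$ and $\epsilon(x)=1$ for $x\neq0$). $\overline{\chi}$ is the inverse of $\chi$, and products of characters are pointwise, e.g. $\overline{B}C(x)=\overline{B}(x)C(x)$. For each $m\ge1$ the finite field Lauricella series is (the subscript $A$ in $F_A^{(m)}$ is part of the name) $$F_A^{(m)}\left[A;B_1,\ldots,B_m;C_1,\ldots,C_m\mid x_1,\ldots,x_m\right]=\sum_{t_1,\ldots,t_m\in\mathbb F_q}\left(\prod_{i=1}^m\epsilon(x_i)\frac{B_iC_i(-1)}{q}B_i(t_i)\overline{B_i}C_i(1-t_i)\right)\overline{A}(1-x_1t_1-\cdots-x_mt_m).$$ *)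

(* Defs.v *)
From HB Require Import structures.
From mathcomp Require Import all_boot all_order all_algebra all_fingroup.
From mathcomp Require Import reals.
From mathcomp Require Export complex.

Set Implicit Arguments.
Unset Strict Implicit.
Unset Printing Implicit Defensive.

Import GRing.Theory.

Local Open Scope ring_scope.
Local Open Scope complex_scope.

Section MultiplicativeCharacters.
Variables (R : realType) (F : finFieldType).

Definition is_mulchar (f : {ffun {unit F} -> R[i]}) :=
  [forall u, f u != 0] && [forall u, forall v, f (u * v)%g == f u * f v].

Record mulchar := MulChar {
  mulchar_units : {ffun {unit F} -> R[i]};
  _ : is_mulchar mulchar_units
}.

HB.instance Definition _ := [isSub for mulchar_units].
HB.instance Definition _ := [Choice of mulchar by <:].

Lemma mulchar_neq0 (chi : mulchar) u : mulchar_units chi u != 0.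
Proof. by have /andP[/forallP chi0 _] := valP chi; exact: chi0. Qed.

Lemma mulchar_unitsM (chi : mulchar) u v :
  mulchar_units chi (u * v)%g = mulchar_units chi u * mulchar_units chi v.
Proof. by have /andP[_ /'forall_forallP chiM] := valP chi; exact/eqP/chiM. Qed.

Lemma mulchar_mul_subproof (chi psi : mulchar) :
  is_mulchar [ffun u => mulchar_units chi u * mulchar_units psi u].
Proof.
apply/andP; split; first by apply/forallP => u; rewrite ffunE mulf_neq0 ?mulchar_neq0.
by apply/'forall_forallP => u v; rewrite !ffunE !mulchar_unitsM mulrACA.
Qed.

Lemma mulchar_triv_subproof : is_mulchar [ffun=> 1].
Proof.
apply/andP; split; first by apply/forallP => u; rewrite ffunE oner_neq0.
by apply/'forall_forallP => u v; rewrite !ffunE mulr1.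
Qed.

Lemma mulchar_inv_subproof (chi : mulchar) :
  is_mulchar [ffun u => (mulchar_units chi u)^-1].
Proof.
apply/andP; split; first by apply/forallP => u; rewrite ffunE invr_neq0 ?mulchar_neq0.
by apply/'forall_forallP => u v; rewrite !ffunE mulchar_unitsM invfM.
Qed.

Definition mulchar_mul (chi psi : mulchar) : mulchar :=
  MulChar (mulchar_mul_subproof chi psi).
Definition mulchar_triv : mulchar := MulChar mulchar_triv_subproof.
Definition mulchar_inv (chi : mulchar) : mulchar :=
  MulChar (mulchar_inv_subproof chi).

Lemma mulchar_mulA : associative mulchar_mul.
Proof. by move=> a b c; apply/val_inj/ffunP => u /=; rewrite !ffunE mulrA. Qed.

Lemma mulchar_mulC : commutative mulchar_mul.
Proof. by move=> a b; apply/val_inj/ffunP => u /=; rewrite !ffunE mulrC. Qed.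

Lemma mulchar_mul1 : left_id mulchar_triv mulchar_mul.
Proof. by move=> a; apply/val_inj/ffunP => u /=; rewrite !ffunE mul1r. Qed.

Lemma mulchar_mulr1 : right_id mulchar_triv mulchar_mul.
Proof. by move=> a; rewrite mulchar_mulC mulchar_mul1. Qed.

Lemma mulchar_mulV : left_inverse mulchar_triv mulchar_inv mulchar_mul.
Proof.
by move=> a; apply/val_inj/ffunP => u /=; rewrite !ffunE mulVf ?mulchar_neq0.
Qed.

Lemma mulchar_mulrV : right_inverse mulchar_triv mulchar_inv mulchar_mul.
Proof. by move=> a; rewrite mulchar_mulC mulchar_mulV. Qed.

HB.instance Definition _ := isGroup.Build mulchar
  mulchar_mulA mulchar_mul1 mulchar_mulr1 mulchar_mulV mulchar_mulrV.

(* Extension of a character to the whole field, with value 0 at 0. *)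
Definition mulchar_ext (chi : mulchar) (x : F) : R[i] :=
  if insub x is Some u then mulchar_units chi u else 0.

End MultiplicativeCharacters.

Coercion mulchar_ext : mulchar >-> Funclass.

(* In group_scope, 1 is the trivial character and chi^-1 is the character *)
(* written with an overline on paper.                                     *)
Definition lauricella_FA (R : realType) (F : finFieldType) (m : nat)
    (A : mulchar R F) (B C : 'I_m -> mulchar R F) (x : 'I_m -> F) : R[i] :=
  \sum_(t : {ffun 'I_m -> F})
    (\prod_(i < m)
       ((1%g : mulchar R F) (x i) * ((B i * C i)%g (-1) / #|F|%:R)
        * B i (t i) * ((B i)^-1 * C i)%g (1 - t i)))
    * (A^-1)%g (1 - \sum_(i < m) x i * t i).

(* Main.v *)
Require Import Defs.
From mathcomp Require Import all_boot all_order all_algebra all_fingroup.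
From mathcomp Require Import reals.
From mathcomp Require Import ring.

Import GRing.Theory.
Local Open Scope ring_scope.

(** The sum over t_k is split at t_k = 1 / x_k.  Away from it, 1 - x_k t_k is
    nonzero and factors out of the argument of A^-1.  At t_k = 1 / x_k that
    argument is the linear form - \sum_(i != k) x_i t_i; extracting - x_l and
    reflecting t_l to 1 - t_l restores a constant term 1, and the reflection
    exchanges the roles of B_l and B_l^-1 C_l. *)

Section MulcharExt.
Context {R : realType} {F : finFieldType}.
Implicit Types (chi psi : mulchar R F) (x y : F).

Lemma mulchar_ext_unit chi (u : {unit F}) :
  chi (val u) = mulchar_units chi u.
Proof. by rewrite /mulchar_ext valK. Qed.

Lemma mulchar_ext0 chi : chi 0 = 0.
Proof. by rewrite /mulchar_ext insubN ?unitr0. Qed.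

(** Case view matching [mulchar_ext]: identities are trivial at 0 and otherwise reduce to the unit
    group. *)
Variant mulchar_arg_spec : F -> Type :=
  | MulcharArg0 : mulchar_arg_spec 0
  | MulcharArgUnit (u : {unit F}) : mulchar_arg_spec (val u).

Lemma mulchar_argP x : mulchar_arg_spec x.
Proof.
have [->|x0] := eqVneq x 0; first exact: MulcharArg0.
have ux : x \is a GRing.unit by rewrite unitfE.
by rewrite -[x]/(val (FinRing.unit F ux)); exact: MulcharArgUnit.
Qed.

Lemma mulchar_extM chi x y : chi (x * y) = chi x * chi y.
Proof.
case: (mulchar_argP x) => [|u]; first by rewrite mul0r mulchar_ext0 mul0r.
case: (mulchar_argP y) => [|v]; first by rewrite mulr0 mulchar_ext0 mulr0.
by rewrite -[_ * _]/(val (u * v)%g) !mulchar_ext_unit mulchar_unitsM.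
Qed.

Lemma mulchar_mulE chi psi x : (chi * psi)%g x = chi x * psi x.
Proof.
case: (mulchar_argP x) => [|u]; first by rewrite !mulchar_ext0 mulr0.
by rewrite !mulchar_ext_unit ffunE.
Qed.

Lemma mulchar_invE chi x : (chi^-1)%g x = (chi x)^-1.
Proof.
case: (mulchar_argP x) => [|u]; first by rewrite !mulchar_ext0 invr0.
by rewrite !mulchar_ext_unit ffunE.
Qed.

Lemma mulchar_trivE x : (1%g : mulchar R F) x = (x != 0)%:R.
Proof.
case: (mulchar_argP x) => [|u]; first by rewrite mulchar_ext0 eqxx.
by rewrite mulchar_ext_unit ffunE -unitfE (valP u).
Qed.

Lemma mulchar_ext_neq0 chi x : x != 0 -> chi x != 0.
Proof.
case: (mulchar_argP x) => [|u]; first by rewrite eqxx.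
by rewrite mulchar_ext_unit mulchar_neq0.
Qed.

Lemma mulchar_ext1 chi : chi 1 = 1.
Proof.
have nz : chi 1 != 0 by rewrite mulchar_ext_neq0 ?oner_neq0.
by apply: (mulfI nz); rewrite -mulchar_extM !mulr1.
Qed.

Lemma mulchar_extV chi x : chi x^-1 = (chi x)^-1.
Proof.
have [->|x0] := eqVneq x 0; first by rewrite invr0 mulchar_ext0 invr0.
apply: (mulfI (mulchar_ext_neq0 chi _ x0)).
by rewrite -mulchar_extM !mulfV ?mulchar_ext1 ?mulchar_ext_neq0.
Qed.

Lemma mulchar_extN1_sqr chi : chi (-1) * chi (-1) = 1.
Proof. by rewrite -mulchar_extM mulrNN mulr1 mulchar_ext1. Qed.

End MulcharExt.

Section FfunLift.
Context {T : finType} {m : nat} (k : 'I_m.+1).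

Definition ffun_insert (a : T) (s : {ffun 'I_m -> T}) : {ffun 'I_m.+1 -> T} :=
  [ffun i => if unlift k i is Some j then s j else a].

Lemma ffun_insert_at a s : ffun_insert a s k = a.
Proof. by rewrite ffunE unlift_none. Qed.

Lemma ffun_insert_lift a s j : ffun_insert a s (lift k j) = s j.
Proof. by rewrite ffunE liftK. Qed.

(** Reindexing along the bijection sending [t] to the pair of [t k] and [t] composed with
    [lift k]. *)
Lemma big_ffun_lift (V : nmodType) (f : {ffun 'I_m.+1 -> T} -> V) :
  \sum_t f t = \sum_a \sum_s f (ffun_insert a s).
Proof.
rewrite pair_big (reindex (fun p => ffun_insert p.1 p.2)) //=.
exists (fun t => (t k, [ffun j => t (lift k j)])) => [[a s]|t] _ /=.
  congr pair; first exact: ffun_insert_at.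
  by apply/ffunP => j; rewrite ffunE ffun_insert_lift.
apply/ffunP => i; case: (unliftP k i) => [j|] ->.
  by rewrite ffun_insert_lift ffunE.
by rewrite ffun_insert_at.
Qed.

End FfunLift.

Section LauricellaAt.
Context {R : realType} {F : finFieldType}.
Implicit Types A : mulchar R F.

Definition lauricella_weight (b c : mulchar R F) (x t : F) : R[i] :=
  (1%g : mulchar R F) x * ((b * c)%g (-1) / #|F|%:R)
    * b t * (b^-1 * c)%g (1 - t).

(* [lauricella_FA] with the constant term 1 replaced by [c]: these sums are
   stable under summing out one variable. *)
Definition lauricella_at {m} A (B C : 'I_m -> mulchar R F) (x : 'I_m -> F)
    (c : F) : R[i] :=
  \sum_(t : {ffun 'I_m -> F})
    (\prod_(i < m) lauricella_weight (B i) (C i) (x i) (t i))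
    * (A^-1)%g (c - \sum_(i < m) x i * t i).

(** The argument enters only through the trivial character, so scaling it by a nonzero factor leaves
    the weight unchanged. *)
Lemma eq_lauricella_weight b c x y t :
  (x == 0) = (y == 0) -> lauricella_weight b c x t = lauricella_weight b c y t.
Proof. by rewrite /lauricella_weight !mulchar_trivE => ->. Qed.

(** With b' = b^-1 c one has b'^-1 c = b, so the two character factors trade places; [c (-1)]
    corrects the sign (b c)(-1) to (b' c)(-1). *)
Lemma lauricella_weight_reflect b c x t :
  lauricella_weight b c x (1 - t) =
    c (-1) * lauricella_weight (b^-1 * c)%g c x t.
Proof.
rewrite /lauricella_weight subKr !(mulchar_mulE, mulchar_invE).
have -> : (b (-1))^-1 = b (-1) by rewrite -mulchar_extV invrN1.
(* Cancelling [c (1 - t)] needs it nonzero; at t = 1 both sides vanish. *)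
have [->|t1] := eqVneq (1 - t) 0; first by rewrite !mulchar_ext0 !(invr0, mul0r, mulr0).
have c0 : c (1 - t) != 0 by rewrite mulchar_ext_neq0.
rewrite invfM invrK mulfVK // -[b (-1) * c (-1) * c (-1)]mulrA mulchar_extN1_sqr.
by ring.
Qed.

Lemma lauricella_at_lift {m} A B C x (k : 'I_m.+1) c :
  lauricella_at A B C x c =
    \sum_tk lauricella_weight (B k) (C k) (x k) tk
      * lauricella_at A (fun j => B (lift k j)) (fun j => C (lift k j))
          (fun j => x (lift k j)) (c - x k * tk).
Proof.
rewrite {1}/lauricella_at (big_ffun_lift k); apply: eq_bigr => a _.
rewrite mulr_sumr; apply: eq_bigr => s _.
rewrite !(bigD1_ord k) //= ffun_insert_at mulrA opprD addrA.
congr (_ * _ * _); first by apply: eq_bigr => j _; rewrite ffun_insert_lift.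
congr mulchar_ext; congr (_ - _).
by apply: eq_bigr => j _; rewrite ffun_insert_lift.
Qed.

(** Multiplicativity of A^-1 extracts [c] from its argument, and the weights do not see the division
    by [c]. *)
Lemma lauricella_at_scale {m} A (B C : 'I_m -> mulchar R F) x c : c != 0 ->
  lauricella_at A B C x c =
    (A^-1)%g c * lauricella_FA A B C (fun i => x i / c).
Proof.
move=> c0; rewrite mulr_sumr; apply: eq_bigr => t _.
rewrite mulrCA -mulchar_extM; congr (_ * _); last first.
  congr mulchar_ext; rewrite mulrBr mulr1 mulr_sumr; congr (_ - _).
  by apply: eq_bigr => i _; rewrite mulrA mulrCA mulfV ?mulr1.
apply: eq_bigr => i _; apply: eq_lauricella_weight.
by rewrite mulf_eq0 invr_eq0 (negPf c0) orbF.
Qed.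

(** Replacing t_l by 1 - t_l turns the linear form into - x_l (1 - t_l - \sum_(i != l) (- x_i / x_l)
    t_i), whence the new arguments; [C l (-1)] comes from the reflected weight. *)
Lemma lauricella_at0 {m} A (B C : 'I_m -> mulchar R F) x (l : 'I_m) :
  x l != 0 ->
  lauricella_at A B C x 0 =
    (A^-1)%g (- x l) * C l (-1)
    * lauricella_FA A (fun i => if i == l then ((B l)^-1 * C l)%g else B i) C
        (fun i => if i == l then 1 else - x i / x l).
Proof.
move=> xl0; pose flip (t : {ffun 'I_m -> F}) : {ffun 'I_m -> F} :=
  [ffun i => if i == l then 1 - t i else t i].
have flipK : involutive flip.
  by move=> t; apply/ffunP => i; rewrite !ffunE; case: eqP => // _; rewrite subKr.
rewrite /lauricella_at (reindex_inj (inv_inj flipK)) mulr_sumr.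
apply: eq_bigr => t _.
rewrite (bigD1 l) //= [in RHS](bigD1 l) //= [in X in A^-1%g (0 - X)](bigD1 l) //=.
rewrite [in X in A^-1%g (1 - X)](bigD1 l) //= !eqxx ffunE eqxx.
(* The reflected weight still carries [x l]; since it is nonzero, it may be replaced by 1. *)
rewrite lauricella_weight_reflect (eq_lauricella_weight _ _ _ 1); last first.
  by rewrite oner_eq0 (negPf xl0).
have -> : \prod_(i < m | i != l)
    lauricella_weight (B i) (C i) (x i) (flip t i) =
  \prod_(i < m | i != l) lauricella_weight
    (if i == l then ((B l)^-1 * C l)%g else B i) (C i)
    (if i == l then 1 else - x i / x l) (t i).
  apply: eq_bigr => i /negPf il; rewrite il ffunE il.
  by apply: eq_lauricella_weight; rewrite mulf_eq0 invr_eq0 (negPf xl0) orbF oppr_eq0.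
have -> : 0 - (x l * (1 - t l) + \sum_(i < m | i != l) x i * flip t i) =
  - x l * (1 - (1 * t l + \sum_(i < m | i != l)
    (if i == l then 1 else - x i / x l) * t i)).
  have -> : \sum_(i < m | i != l) (if i == l then 1 else - x i / x l) * t i =
    - (x l)^-1 * \sum_(i < m | i != l) x i * flip t i.
    rewrite mulr_sumr; apply: eq_bigr => i /negPf il; rewrite il ffunE il.
    by ring.
  by field.
rewrite mulchar_extM /lauricella_weight; ring.
Qed.

End LauricellaAt.

(* The list (v_i)_{i <> k}, in increasing order of i, is
   [fun j : 'I_n.-1 => v (lift k j)]. *)
Theorem theorem3p2 (R : realType) (p r : nat) (F : finFieldType)
    (p_prime : prime p) (p_odd : odd p) (r_ge1 : (1 <= r)%N)
    (cardF : #|F| = (p ^ r)%N)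
    (n : nat) (n_ge2 : (2 <= n)%N)
    (A : mulchar R F) (B C : 'I_n -> mulchar R F) (x : 'I_n -> F)
    (k l : 'I_n) (neq_kl : k != l) (xl_neq0 : x l != 0) (xk_neq0 : x k != 0) :
  let B' := fun i => if i == l then ((B l)^-1 * C l)%g else B i in
  let y := fun i => if i == l then 1 else - x i / x l in
  lauricella_FA A B C x =
    (B k * C k)%g (-1) / #|F|%:R
      * ((B k)^-1 * C k)%g (x k - 1) * ((C k)^-1)%g (x k)
      * (A^-1)%g (- x l) * C l (-1)
      * lauricella_FA A
          (fun j : 'I_n.-1 => B' (lift k j))
          (fun j : 'I_n.-1 => C (lift k j))
          (fun j : 'I_n.-1 => y (lift k j))
    + (B k * C k)%g (-1) / #|F|%:R
      * \sum_(tk : F | tk != (x k)^-1)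
          (B k tk * ((B k)^-1 * C k)%g (1 - tk) * (A^-1)%g (1 - x k * tk)
           * lauricella_FA A
               (fun j : 'I_n.-1 => B (lift k j))
               (fun j : 'I_n.-1 => C (lift k j))
               (fun j : 'I_n.-1 => x (lift k j) / (1 - x k * tk))).
Proof.
(* Writing n as m + 1 makes [n.-1] reduce to [m], as the lemma on summing out t_k requires. *)
move=> B' y; case: n n_ge2 B C x k l neq_kl xl_neq0 xk_neq0 @B' @y => // m _.
move=> B C x k l neq_kl xl_neq0 xk_neq0 B' y /=.
have -> : lauricella_FA A B C x = lauricella_at A B C x 1 by [].
(* At t_k = 1 / x_k the remaining constant term is 0. *)
rewrite (lauricella_at_lift _ _ _ _ k) (bigD1 (x k)^-1) //= mulfV // subrr.
congr (_ + _); last first.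
  rewrite mulr_sumr; apply: eq_bigr => tk tk_neq.
  have nz : 1 - x k * tk != 0.
    rewrite subr_eq0 eq_sym; apply: contra tk_neq => /eqP xt1.
    by apply/eqP/(mulfI xk_neq0); rewrite xt1 mulfV.
  by rewrite lauricella_at_scale // /lauricella_weight mulchar_trivE xk_neq0 mulr1n; ring.
(* As l differs from k, it survives the deletion of k, at position [l']. *)
case: (unliftP k l) neq_kl => [l' def_l _|->]; last by rewrite eqxx.
have lift_eq j : (lift k j == l) = (j == l') by rewrite def_l (inj_eq lift_inj).
rewrite (lauricella_at0 _ _ _ _ l') -?def_l //.
have -> : lauricella_weight (B k) (C k) (x k) (x k)^-1 =
  (B k * C k)%g (-1) / #|F|%:R
    * ((B k)^-1 * C k)%g (x k - 1) * ((C k)^-1)%g (x k).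
  rewrite /lauricella_weight mulchar_trivE xk_neq0 mulr1n.
  (* The factor 1 / x_k contributes B_k(x_k) C_k(x_k)^-1, and its B_k part cancels against B_k(1 /
     x_k). *)
  have -> : 1 - (x k)^-1 = (x k - 1) * (x k)^-1 by rewrite mulrBl mulfV ?mul1r.
  rewrite mulchar_extM !(mulchar_mulE, mulchar_invE, mulchar_extV).
  have Bk0 : B k (x k) != 0 by rewrite mulchar_ext_neq0.
  rewrite mul1r invfM invrK [_ * (B k (x k) * _)]mulrCA.
  by rewrite [_ * (B k (x k) * _)]mulrA divfK // !mulrA.
rewrite !mulrA; congr (_ * _).
apply: eq_bigr => t _; congr (_ * _).
  by apply: eq_bigr => i _; rewrite /B' /y lift_eq.
by congr mulchar_ext; congr (_ - _); apply: eq_bigr => i _; rewrite /y lift_eq.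
Qed.
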